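(* Let $N,L$ be positive integers. For any $\epsilon>0$ and any infinite subset $X\subset \mathbb{T}^N$ there exists a continuous homomorphism $T:\mathbb{T}^N\rightarrow\mathbb{T}^L$ such that $TX$ is $\epsilon$-dense in $\mathbb{T}^L$.
   Context: $\mathbb{T}=\mathbb{R}/\mathbb{Z}$. A subset of $\mathbb{T}^L$ is $\epsilon$-dense in $\mathbb{T}^L$ if it intersects every box (product of intervals in $\mathbb{T}$) of side length $2\epsilon$. Continuous homomorphisms $\mathbb{T}^N\to\mathbb{T}^L$ are exactly the maps $\mathbf{x}\mapsto T\mathbf{x}$ given by left multiplication by an $L\times N$ integer matrix $T$. *)

(* Defs.v *)
From HB Require Import structures.
From mathcomp Require Import all_boot all_order all_algebra.
From mathcomp Require Import all_classical all_reals all_analysis.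

Set Implicit Arguments.
Unset Strict Implicit.
Unset Printing Implicit Defensive.

Import Order.TTheory GRing.Theory Num.Theory.
Import numFieldNormedType.Exports.

Local Open Scope classical_set_scope.
Local Open Scope ring_scope.
Local Open Scope quotient_scope.

Definition integers (R : realType) : {pred R} := fun x => x \is a Num.int.

Lemma integers_zmod_closed (R : realType) : zmod_closed (@integers R).
Proof. by split=> [|x y]; [exact: rpred0|exact: rpredB]. Qed.

HB.instance Definition _ (R : realType) :=
  GRing.isZmodClosed.Build R (@integers R) (@integers_zmod_closed R).

(* R/Z: [ring_quotient] provides the group structure, [quotient_topology] the
   topology.  The latter is an alias that only transports the choice structure,
   so the group structure has to be declared on it again. *)
Definition circle (R : realType) : Type :=
  quotient_topology {ideal_quot @integers R}.

HB.instance Definition _ (R : realType) := Topological.on (circle R).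
HB.instance Definition _ (R : realType) :=
  GRing.isZmodule.Build (circle R)
    (@Quotient.addqA R (@integers R)) (@Quotient.addqC R (@integers R))
    (@Quotient.add0q R (@integers R)) (@Quotient.addNq R (@integers R)).

Definition to_circle (R : realType) (x : R) : circle R :=
  \pi_{ideal_quot @integers R} x.

(* Column vectors inherit from [circle R] the componentwise addition and, via
   [matrix_topology], the product topology. *)
Notation torus R n := 'cV[circle R]_n.

(* [bl] and [br] select whether each endpoint is included, so intervals of every
   kind are covered.  For len > 1 the interval wraps around the whole circle. *)
Definition is_circle_interval (R : realType) (len : R) (J : set (circle R)) :=
  exists (bl br : bool) (a : R),
    J = @to_circle R @` [set` Interval (BSide bl a) (BSide br (a + len))].

Definition box (R : realType) (n : nat) (J : 'I_n -> set (circle R)) :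
    set (torus R n) :=
  [set y | forall i : 'I_n, J i (y i ord0)].

Definition eps_dense (R : realType) (n : nat) (eps : R)
    (A : set (torus R n)) : Prop :=
  forall J : 'I_n -> set (circle R),
    (forall i, is_circle_interval (2 * eps) (J i)) -> A `&` box J !=set0.

(* Main.v *)
(* Some coordinate of X takes infinitely many values, so one may assume N = 1 and
   look for T = (n_1, ..., n_L).  Embed the circle in the complex unit circle and
   take a nonnegative trigonometric polynomial f of degree p on the L-torus,
   concentrated near a target point c and with mean mu^L.  For fixed w,
   the equation z^s w^t = z^p w^p has finitely many solutions z when s <> p, so the
   image of X contains k points x_i for which every relation x_i^s x_j^t = x_i^p x_j^p with
   i <> j and s, t <= 2p is trivial.  When n is uniform in [0, M)^L and M grows, the
   variables f (x_i^n) are asymptotically uncorrelated with mean mu^L, so for k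
   large their average over i is close to mu^L for some n, simultaneously for all
   c in a finite net of the torus; some x_i^n is then close to c. *)

Require Import Defs.
From HB Require Import structures.
From mathcomp Require Import all_boot all_order all_algebra.
From mathcomp Require Import all_classical all_reals all_analysis.
From mathcomp.real_closed Require Import complex.
From mathcomp Require Import ring lra zify.

Import Order.TTheory GRing.Theory Num.Theory.
Import numFieldNormedType.Exports.

Local Open Scope classical_set_scope.
Local Open Scope ring_scope.

(** * Elementary limits and estimates *)

Lemma cvg_mean (R : realType) (h : nat -> R) (al K : R) :
  (forall M, `|\sum_(m < M) h m - al *+ M| <= K) ->
  (\sum_(m < M) h m / M%:R) @[M --> \oo] --> al.
Proof.
move=> hK; apply/cvgrPdist_lt => e e0.
near=> M.
have M0 : 0 < M%:R :> R by rewrite ltr0n; near: M; exact: nbhs_infty_gt.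
rewrite -mulr_suml.
have -> : al - (\sum_(m < M) h m) / M%:R = - (\sum_(m < M) h m - al *+ M) / M%:R.
  by rewrite -mulr_natr; field; rewrite gt_eqF.
rewrite mulNr normrN normrM normfV (gtr0_norm M0) ltr_pdivrMr //.
apply: le_lt_trans (hK M) _.
rewrite mulrC -ltr_pdivrMr //.
near: M; exact: nbhs_infty_gtr.
Unshelve. all: by end_near. Qed.

(** With [rho^-1 = 1 + h] and [p = q * L.+1], Bernoulli's inequality bounds [rho^-1 ^+ p] below by
    [L.+1] factors [1 + q%:R * h]. Up to the constant [A ^+ L], [L] of them absorb the polynomial,
    and the last one exceeds [2 * A ^+ L]. *)
Lemma poly_lt_geom (R : realType) (rho : R) (L : nat) :
  0 < rho < 1 -> exists p : nat, 2 * (p.*2.+1)%:R ^+ L * rho ^+ p < 1.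
Proof.
case/andP=> rho0 rho1; pose h := rho^-1 - 1.
have h0 : 0 < h by rewrite subr_gt0 invf_gt1.
(* [A] is chosen so that [2 p + 1 <= A * (1 + q%:R * h)] for every [q]. *)
pose A := 1 + 2 * L.+1%:R / h.
have A0 : 0 < A by rewrite ltr_pwDl // divr_ge0 // ltW.
have bern q : 1 + q%:R * h <= (1 + h) ^+ q.
  elim: q => [|q IH]; first by rewrite mul0r addr0 expr0.
  rewrite exprS; apply: le_trans (ler_wpM2l _ IH); last by rewrite addr_ge0 // ltW.
  rewrite -natr1; have : 0 <= q%:R :> R by []. nra.
pose q := Num.Def.archi_bound (2 * A ^+ L / h).
have qlt : 2 * A ^+ L < 1 + q%:R * h.
  rewrite -ltrBlDl; apply: (@lt_trans _ _ (2 * A ^+ L)).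
    by rewrite ltrBlDl ltrDr.
  rewrite -ltr_pdivrMr //; apply: archi_boundP.
  by rewrite divr_ge0 ?mulr_ge0 ?exprn_ge0 // ltW.
exists (q * L.+1)%N.
have -> : rho ^+ (q * L.+1) = ((1 + h) ^+ (q * L.+1))^-1.
  by rewrite /h addrC subrK exprVn invrK.
rewrite ltr_pdivrMr ?mul1r; last by rewrite exprn_gt0 // addr_gt0.
have qh0 : 0 < 1 + q%:R * h by rewrite ltr_pwDl // mulr_ge0 // ltW.
apply: (@lt_le_trans _ _ ((1 + q%:R * h) ^+ L.+1)); last first.
  by rewrite exprM; apply: (lerXn2r _ _ _ (bern q)); rewrite nnegrE;
    apply: ltW => //; rewrite exprn_gt0 // addr_gt0.
apply: (@le_lt_trans _ _ (2 * (A * (1 + q%:R * h)) ^+ L)).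
  rewrite ler_pM2l //; apply: lerXn2r; rewrite ?nnegrE; first by [].
    by apply: ltW; rewrite mulr_gt0.
  rewrite -natr1 -mul2n !natrM /A.
  have -> : (1 + 2 * L.+1%:R / h) * (1 + q%:R * h) =
     1 + q%:R * h + 2 * L.+1%:R / h + 2 * (q%:R * L.+1%:R).
    by field; rewrite gt_eqF.
  rewrite [leLHS]addrC lerD2r -addrA lerDl.
  by rewrite addr_ge0 // ?divr_ge0 ?mulr_ge0 // ltW.
by rewrite exprMn mulrA exprS ltr_pM2r // exprn_gt0.
Qed.

(** Induction on [p], using (p + 1) C(2p + 2, p + 1) = 2 (2p + 1) C(2p, p). *)
Lemma central_bin_ge (p : nat) : (4 ^ p <= p.*2.+1 * 'C(p.*2, p))%N.
Proof.
elim: p => [//|p IH].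
have h1 := mul_bin_diag p.*2.+1 p.
have h2 := mul_bin_diag p.*2.+2 p.
have h3 := mul_bin_left p.*2.+1 p.
rewrite doubleS expnS.
move: h1 h2 h3 IH => /=.
move: ('C(p.*2, p)) ('C(p.*2.+1, p.+1)) ('C(p.*2.+1, p)) ('C(p.*2.+2, p.+1)).
move=> a b c d h1 h2 h3 IH; have ebc : b = c.
  apply/eqP; rewrite -(eqn_pmul2l (ltn0Sn p)) h3; apply/eqP; congr muln; lia.
rewrite -(leq_pmul2l (ltn0Sn p)); nia.
Qed.

(** * Means of trigonometric polynomials along powers *)

Lemma norm_geom_sum_le (C : numFieldType) (z : C) (M : nat) :
  `|z| = 1 -> z != 1 -> `|\sum_(m < M) z ^+ m| <= 2 / `|z - 1|.
Proof.
move=> z1 zn1; have nz : 0 < `|z - 1| by rewrite normr_gt0 subr_eq0.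
rewrite ler_pdivlMr // mulrC -normrM -subrX1.
by rewrite (le_trans (ler_normB _ _)) // normrX z1 expr1n normr1.
Qed.

(** A frequency [zt i] other than 1 has geometric sums bounded independently of [M], so division by
    [M] removes it in the limit; the frequencies equal to 1 contribute their coefficients. *)
Lemma cvg_mean_trig (R : realType) (I : finType) (a zt : I -> R[i])
    (h : nat -> R) (al : R) :
  (forall i, `|zt i| = 1) ->
  (forall m, (h m)%:C%C = \sum_i a i * zt i ^+ m) ->
  al%:C%C = \sum_(i | zt i == 1) a i ->
  (\sum_(m < M) h m / M%:R) @[M --> \oo] --> al.
Proof.
move=> zt1 hE alE.
pose K : R[i] := \sum_(i | zt i != 1) `|a i| * (2 / `|zt i - 1|).
have K0 : 0 <= K by apply: sumr_ge0 => i _; rewrite mulr_ge0 // divr_ge0.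
apply: (@cvg_mean _ _ _ (complex.Re K)) => M.
rewrite -lecR (RRe_real (ger0_real K0)).
have -> : `|\sum_(m < M) h m - al *+ M|%:C%C =
    `|(\sum_(m < M) h m - al *+ M)%:C%C|.
  by rewrite normc_def /= expr0n addr0 sqrtr_sqr.
rewrite rmorphB rmorphMn rmorph_sum /=.
under eq_bigr do rewrite hE.
rewrite exchange_big /= (bigID (fun i => zt i == 1)) /=.
rewrite [X in X + _ - _](eq_bigr (fun i => a i *+ M)); last first.
  move=> i /eqP ->; under eq_bigr do rewrite expr1n mulr1.
  by rewrite sumr_const card_ord.
rewrite alE -sumrMnl addrC addKr.
apply: le_trans (ler_norm_sum _ _ _) _; apply: ler_sum => i zi.
by rewrite -mulr_sumr normrM ler_wpM2l // norm_geom_sum_le.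
Qed.

(* On the unit circle this is (|1 + w| / 2) ^ (2 p), a Laurent polynomial of degree
   [p] in [w], with constant coefficient [kernel_mean R p]. *)
Definition kernel {R : realType} (p : nat) (w : R[i]) : R :=
  ((1 + complex.Re w) / 2) ^+ p.

Definition kernel_mean (R : realType) (p : nat) : R := 'C(p.*2, p)%:R / 4 ^+ p.

Lemma unit_invc (R : realType) (w : R[i]) : `|w| = 1 -> w^-1 = w^*%C.
Proof. by move=> w1; rewrite invc_norm w1 expr1n invr1 mul1r. Qed.

(** On the unit circle (1 + Re w) / 2 = (w + 1)^2 / (4 w), and the binomial theorem expands the
    [p]-th power. *)
Lemma kernelE (R : realType) (p : nat) (w : R[i]) : `|w| = 1 ->
  (kernel p w)%:C%C =
  \sum_(s < p.*2.+1) ('C(p.*2, s)%:R / 4 ^+ p) * (w ^+ s / w ^+ p).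
Proof.
move=> w1.
have w0 : w != 0 by rewrite -normr_eq0 w1 oner_eq0.
rewrite rmorphXn /=.
have -> : ((1 + complex.Re w) / 2)%:C%C = (w + 1) ^+ 2 / (4 * w).
  rewrite rmorphM rmorphD /= fmorphV rmorph1 rmorph_nat ReJ_add -unit_invc //.
  by field; rewrite w0.
rewrite expr_div_n -exprM mul2n exprDn mulr_suml.
rewrite (reindex_inj rev_ord_inj) /=; apply: eq_bigr => s _.
rewrite expr1n mulr1 subSS bin_sub -1?ltnS // subKn -1?ltnS // exprMn.
rewrite -mulr_natr; field.
by rewrite !expf_neq0.
Qed.

(** The hypothesis on [z] makes [s = p] the only resonant frequency, so only the constant
    coefficient survives. *)
Lemma cvg_mean_kernel (R : realType) (p : nat) (v z : R[i]) :
  `|v| = 1 -> `|z| = 1 ->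
  (forall s, (s <= p.*2)%N -> z ^+ s = z ^+ p -> s = p) ->
  (\sum_(m < M) kernel p (v * z ^+ m) / M%:R) @[M --> \oo] --> kernel_mean R p.
Proof.
move=> v1 z1 zindep.
have v0 : v != 0 by rewrite -normr_eq0 v1 oner_eq0.
have z0 : z != 0 by rewrite -normr_eq0 z1 oner_eq0.
apply: (@cvg_mean_trig _ 'I_(p.*2.+1)
  (fun s => 'C(p.*2, s)%:R / 4 ^+ p * (v ^+ s / v ^+ p))
  (fun s => z ^+ s / z ^+ p) (fun m => kernel p (v * z ^+ m))) => [s|m|].
- by rewrite normrM normfV !normrX z1 !expr1n divr1.
- rewrite kernelE; last by rewrite normrM normrX v1 z1 expr1n mulr1.
  apply: eq_bigr => s _; rewrite !exprMn !exprVn -!exprM ![(m * _)%N]mulnC.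
  field.
  by rewrite !expf_neq0.
- have lt : (p < p.*2.+1)%N by rewrite ltnS -addnn leq_addr.
  rewrite (big_pred1 (Ordinal lt)) /= => [|s].
    rewrite divff ?expf_neq0 // mulr1 /kernel_mean.
    by rewrite rmorphM fmorphV rmorphXn !rmorph_nat.
  rewrite -(inj_eq (mulIf (expf_neq0 p z0))) divfK ?expf_neq0 // mul1r.
  apply/eqP/eqP => [/zindep e|-> //]; apply: val_inj => /=; apply: e.
  by rewrite -ltnS.
Qed.

(** Here only the pair [(p, p)] is resonant. That the limit is the product of the two means is the
    asymptotic uncorrelatedness. *)
Lemma cvg_mean_kernel2 (R : realType) (p : nat) (v z w : R[i]) :
  `|v| = 1 -> `|z| = 1 -> `|w| = 1 ->
  (forall s t, (s <= p.*2)%N -> (t <= p.*2)%N ->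
    z ^+ s * w ^+ t = z ^+ p * w ^+ p -> s = p /\ t = p) ->
  (\sum_(m < M) (kernel p (v * z ^+ m) * kernel p (v * w ^+ m)) / M%:R)
    @[M --> \oo] --> kernel_mean R p ^+ 2.
Proof.
move=> v1 z1 w1 zindep.
have v0 : v != 0 by rewrite -normr_eq0 v1 oner_eq0.
have z0 : z != 0 by rewrite -normr_eq0 z1 oner_eq0.
have w0 : w != 0 by rewrite -normr_eq0 w1 oner_eq0.
pose c (s : 'I_(p.*2.+1)) : R[i] := 'C(p.*2, s)%:R / 4 ^+ p * (v ^+ s / v ^+ p).
apply: (@cvg_mean_trig _ ('I_(p.*2.+1) * 'I_(p.*2.+1))%type
  (fun st => c st.1 * c st.2)
  (fun st => z ^+ st.1 / z ^+ p * (w ^+ st.2 / w ^+ p))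
  (fun m => kernel p (v * z ^+ m) * kernel p (v * w ^+ m))) => [s|m|].
- by rewrite !normrM !normfV !normrX z1 w1 !expr1n !divr1 mulr1.
- rewrite rmorphM /= !kernelE ?normrM ?normrX ?v1 ?z1 ?w1 ?expr1n ?mulr1 //.
  rewrite big_distrlr /= pair_big /=; apply: eq_bigr => -[s t] _ /=.
  rewrite /c !exprMn !exprVn -!exprM ![(m * _)%N]mulnC.
  by field; rewrite !expf_neq0.
- have lt : (p < p.*2.+1)%N by rewrite ltnS -addnn leq_addr.
  rewrite (big_pred1 (Ordinal lt, Ordinal lt)) /= => [|[s t] /=].
    rewrite /c /= divff ?expf_neq0 // mulr1 /kernel_mean.
    by rewrite rmorphXn rmorphM /= fmorphV rmorphXn !rmorph_nat.
  rewrite mulf_div -(inj_eq (mulIf (mulf_neq0 (expf_neq0 p z0) (expf_neq0 p w0)))).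
  rewrite divfK ?mulf_neq0 ?expf_neq0 // mul1r.
  apply/eqP/eqP => [/zindep e|[-> ->] //].
  have [es et] := e (ltnSE (ltn_ord s)) (ltnSE (ltn_ord t)).
  by congr pair; apply: val_inj.
Qed.

(** * Points without short multiplicative relations *)

Lemma finite_root_set (C : closedFieldType) (P : {poly C}) :
  P != 0 -> finite_set [set z | root P z].
Proof.
move=> P0; have [s Ps] := closed_field_poly_normal P.
apply: (@sub_finite_set _ _ [set` s]); last exact: finite_seq.
by move=> z /=; rewrite Ps rootZ ?lead_coef_eq0 // root_prod_XsubC.
Qed.

(* The exponents [s - p] and [t - p] range over the integers of absolute value at
   most [p]. *)
Definition indep {C : nzRingType} (p : nat) (z w : C) :=
  forall s t, (s <= p.*2)%N -> (t <= p.*2)%N ->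
    z ^+ s * w ^+ t = z ^+ p * w ^+ p -> s = p /\ t = p.

(** Greedy choice: each new point avoids the finitely many roots of a polynomial built from the
    earlier points. *)
Lemma exists_indep_seq (C : closedFieldType) (U : set C) (p k : nat) :
  infinite_set U -> (forall z, U z -> z != 0) ->
  exists xs : seq C, [/\ size xs = k, forall z, z \in xs -> U z,
    forall z s, z \in xs -> (s <= p.*2)%N -> z ^+ s = z ^+ p -> s = p &
    pairwise (fun z w => `[< indep p z w >]) xs].
Proof.
move=> Uinf U0; elim: k => [|k [xs [xsk xsU xs1 xsp]]].
  by exists [::]; split.
(* The roots of [P] are the numbers satisfying a forbidden relation with some
   element of [xs], or with [1] for the relations in [y] alone. *)
pose P : {poly C} := \prod_(w <- 1 :: xs)
  \prod_(st : 'I_(p.*2.+1) * 'I_(p.*2.+1) | st.1 != p :> nat)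
  (w ^+ st.2 *: 'X^(st.1) - w ^+ p *: 'X^p).
have nz w : w \in 1 :: xs -> w != 0.
  by rewrite inE => /predU1P[->|/xsU/U0//]; exact: oner_neq0.
have P0 : P != 0.
  rewrite prodf_seq_neq0; apply/allP => w /nz w0 /=.
  (* As [s] differs from [p], the coefficient of degree [s] is a power of [w], hence nonzero. *)
  rewrite prodf_seq_neq0; apply/allP => -[s t] _ /=; apply/implyP => sp.
  apply/eqP => /(congr1 (fun q : {poly C} => q`_s)) /eqP.
  rewrite coefB !coefZ !coefXn eqxx (negbTE sp) mulr0 subr0 mulr1 coef0.
  by rewrite expf_eq0 (negbTE w0) andbF.
have /infinite_setN0[y [Uy /negP Py]] :=
  infinite_setD Uinf (finite_root_set _ _ P0).
have yfree w s t : w \in 1 :: xs -> (s <= p.*2)%N -> (t <= p.*2)%N ->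
    y ^+ s * w ^+ t = y ^+ p * w ^+ p -> s = p.
  move=> ws sp tp e; apply/eqP; apply: contraNT Py => nsp.
  rewrite /root horner_prod prodf_seq_eq0; apply/hasP; exists w => //=.
  rewrite horner_prod (bigD1 (@Ordinal p.*2.+1 s sp, @Ordinal p.*2.+1 t tp)) //=.
  by rewrite !hornerE /= [_ * y ^+ s]mulrC e [y ^+ p * _]mulrC subrr mul0r.
exists (y :: xs); split => /=; rewrite ?xsk //.
- by move=> z; rewrite inE => /predU1P[->|/xsU].
- move=> z s; rewrite inE => /predU1P[->|/xs1 h//]; last exact: h.
  by move=> sp e; apply: (yfree 1 s 0%N); rewrite ?mem_head // !expr1n e.
- rewrite xsp andbT; apply/allP => w wxs; apply/asboolP => s t sp tp e.
  (* Once [s = p], cancelling [y ^+ p] leaves a relation in [w] alone, excluded by [xs1]. This is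
     why factors of [P] with [s <> p] suffice. *)
  have es : s = p by apply: (yfree w s t) => //; rewrite inE wxs orbT.
  split=> //; apply: (xs1 w) => //; move: e; rewrite es.
  by apply: mulfI; rewrite expf_neq0 // U0.
Qed.

(** * The second moment method *)

(** Average over [n] uniform in [0, M)^L the squared deviation, summed over all [c]. In the limit
    the off-diagonal covariances vanish and each diagonal term is bounded by 1, so the average is
    eventually below [theta]. Summing over [c] makes one [n] serve every [c]. *)
Lemma second_moment (R : realType) (I : finType) (k L : nat)
    (g : I -> 'I_k -> nat -> R) (mu theta : R) :
  (forall c i m, 0 <= g c i m <= 1) -> 0 <= mu <= 1 ->
  (forall c i, (\sum_(m < M) g c i m / M%:R) @[M --> \oo] --> mu) ->
  (forall c i j, i != j ->
    (\sum_(m < M) (g c i m * g c j m) / M%:R) @[M --> \oo] --> mu ^+ 2) ->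
  (#|{ffun 'I_L -> I}| * k)%:R < theta ->
  exists n : 'I_L -> nat, forall c : {ffun 'I_L -> I},
    (\sum_i (\prod_l g (c l) i (n l) - mu ^+ L)) ^+ 2 < theta.
Proof.
move=> g01 /andP[mu0 mu1] cvg1 cvg2 theta_gt.
pose S c i M := \sum_(m < M) g c i m / M%:R.
pose P c i j M := \sum_(m < M) (g c i m * g c j m) / M%:R.
(* For each [M > 0], [W0 c i j M] bounds the covariance of the products indexed by
   [i] and [j] when [n] is uniform in [0, M)^L. *)
pose W0 (c : {ffun 'I_L -> I}) (i j : 'I_k) M := if i == j then 1 else
  \prod_l P (c l) i j M - mu ^+ L * \prod_l S (c l) i M
    - mu ^+ L * \prod_l S (c l) j M + mu ^+ L ^+ 2.
pose W M := \sum_c \sum_i \sum_j W0 c i j M.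
have cvg_prod_mean (F : 'I_L -> nat -> R) (a : R) :
    (forall l, F l M @[M --> \oo] --> a) ->
    (\prod_l F l M) @[M --> \oo] --> a ^+ L.
  move=> Fa; have -> : a ^+ L = \prod_(l < L) a by rewrite prodr_const card_ord.
  by apply: cvg_big => // x; exact: mul_continuous.
have W0cvg c i j : W0 c i j M @[M --> \oo] --> ((i == j)%:R : R).
  rewrite /W0; case: (altP (i =P j)) => [_|ij]; first exact: cvg_cst.
  have -> : 0%:R = mu ^+ 2 ^+ L - mu ^+ L * mu ^+ L - mu ^+ L * mu ^+ L
      + mu ^+ L ^+ 2 :> R.
    by rewrite -!exprM mulnC exprM; ring.
  apply: cvgD; last exact: cvg_cst.
  apply: cvgB; last first.
    by apply: cvgM; [exact: cvg_cst|apply: cvg_prod_mean => l; exact: cvg1].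
  apply: cvgB; last first.
    by apply: cvgM; [exact: cvg_cst|apply: cvg_prod_mean => l; exact: cvg1].
  by apply: cvg_prod_mean => l; exact: cvg2.
have Wcvg : W M @[M --> \oo] --> ((#|{ffun 'I_L -> I}| * k)%:R : R).
  have -> : (#|{ffun 'I_L -> I}| * k)%:R =
      \sum_(c : {ffun 'I_L -> I}) \sum_(i < k) \sum_(j < k) ((i == j)%:R : R).
    rewrite (eq_bigr (fun=> k%:R)) => [|c _].
      by rewrite sumr_const natrM mulr_natl.
    rewrite (eq_bigr (fun=> 1)) => [|i _]; first by rewrite sumr_const card_ord.
    by rewrite (bigD1 i) //= eqxx big1 ?addr0 // => j; rewrite eq_sym => /negbTE ->.
  apply: cvg_big => [|c _]; first exact: add_continuous.
  apply: cvg_big => [|i _]; first exact: add_continuous.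
  by apply: cvg_big => [|j _]; [exact: add_continuous|exact: W0cvg].
have [M [M0 WM]] : exists M, (0 < M)%N /\ W M < theta.
  have h1 : \forall M \near \oo, W M < theta by apply: (cvgr_lt _ Wcvg).
  have h2 := nbhs_infty_gt 0.
  have [M [? ?]] := @filter_ex _ _ _ _ (filterI h2 h1); by exists M.
(* The weight of each [n] in the uniform distribution. *)
pose q : R := (M%:R^-1) ^+ L.
have q0 : 0 <= q by rewrite exprn_ge0 // invr_ge0.
pose f (n : {ffun 'I_L -> 'I_M}) (c : {ffun 'I_L -> I}) i := \prod_l g (c l) i (n l).
(* The coordinates of [n] are independent, so the expectation of a product over [l] factorizes. *)
have Eprod (F : 'I_L -> nat -> R) :
    \sum_(n : {ffun 'I_L -> 'I_M}) (\prod_l F l (n l)) * q =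
    \prod_l \sum_(m < M) F l m / M%:R.
  rewrite bigA_distr_bigA /=; apply: eq_bigr => n _.
  by rewrite big_split /= prodr_const card_ord.
have E1 : \sum_(n : {ffun 'I_L -> 'I_M}) q = 1.
  rewrite sumr_const card_ffun !card_ord -mulr_natl natrX /q -exprMn.
  by rewrite divff ?expr1n // pnatr_eq0 -lt0n.
have f01 n c i : 0 <= f n c i <= 1.
  apply/andP; split; first by apply: prodr_ge0 => l _; case/andP: (g01 (c l) i (n l)).
  by apply: prodr_ile1 => l _; exact: g01.
have muL : 0 <= mu ^+ L <= 1 by rewrite exprn_ge0 //= exprn_ile1.
have W0ge c i j :
    \sum_n (f n c i - mu ^+ L) * (f n c j - mu ^+ L) * q <= W0 c i j M.
  rewrite /W0; case: (altP (i =P j)) => [->|ij].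
    rewrite -[leRHS]E1; apply: ler_sum => n _; rewrite ler_piMl //.
    have := f01 n c j; move: muL; move: (f n c j) (mu ^+ L) => x y.
    by move=> /andP[? ?] /andP[? ?]; nra.
  rewrite -(Eprod (fun l m => g (c l) i m * g (c l) j m)).
  rewrite -(Eprod (fun l => g (c l) i)) -(Eprod (fun l => g (c l) j)).
  rewrite -[mu ^+ L ^+ 2]mulr1 -[X in _ + mu ^+ L ^+ 2 * X]E1.
  rewrite !mulr_sumr -!sumrB -big_split /= le_eqVlt; apply/orP; left; apply/eqP.
  apply: eq_bigr => n _; rewrite /f big_split /=.
  by ring.
(* Some [n] does no worse than the average. *)
have [n nP] : exists n : {ffun 'I_L -> 'I_M},
    \sum_c (\sum_i (f n c i - mu ^+ L)) ^+ 2 < theta.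
  apply/not_existsP => hn; have := WM; apply/negP; rewrite -leNgt.
  rewrite -[theta]mulr1 -E1 mulr_sumr.
  apply: (@le_trans _ _ (\sum_n (\sum_c (\sum_i (f n c i - mu ^+ L)) ^+ 2) * q)).
    by apply: ler_sum => n _; rewrite ler_wpM2r // leNgt; apply/negP/hn.
  under eq_bigr do rewrite mulr_suml.
  rewrite exchange_big; apply: ler_sum => c _ /=.
  under eq_bigr => n _ do (rewrite expr2 big_distrlr /= mulr_suml;
     under eq_bigr => i _ do rewrite mulr_suml).
  rewrite exchange_big; apply: ler_sum => i _ /=.
  by rewrite exchange_big; apply: ler_sum => j _ /=.
exists (fun l => n l) => c; apply: le_lt_trans nP.
by rewrite (bigD1 c) //= lerDl; apply: sumr_ge0 => c' _; exact: sqr_ge0.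
Qed.

(** * Density of simultaneous powers on the unit circle *)

Lemma kernel_mean_ge (R : realType) (p : nat) :
  1 <= p.*2.+1%:R * kernel_mean R p.
Proof.
rewrite /kernel_mean mulrA ler_pdivlMr ?exprn_gt0 // mul1r.
by rewrite -natrX -natrM ler_nat central_bin_ge.
Qed.

Lemma kernel_mean_ge0_le1 (R : realType) (p : nat) : 0 <= kernel_mean R p <= 1.
Proof.
rewrite divr_ge0 ?exprn_ge0 //= ler_pdivrMr ?exprn_gt0 // mul1r -natrX ler_nat.
have -> : (4 ^ p = (1 + 1) ^ p.*2)%N by rewrite -mul2n expnM.
have lt : (p < p.*2.+1)%N by rewrite ltnS -addnn leq_addr.
by rewrite expnDn (bigD1 (Ordinal lt)) //= !exp1n !muln1 leq_addr.
Qed.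

Lemma kernel_ge0_le1 (R : realType) (p : nat) (w : R[i]) :
  `|w| = 1 -> 0 <= kernel p w <= 1.
Proof.
move=> w1; have : `|complex.Re w| <= 1.
  by rewrite -lecR (le_trans (normc_ge_Re w)) // w1.
rewrite ler_norml => /andP[h1 h2].
by rewrite exprn_ge0 ?exprn_ile1 //; lra.
Qed.

(** The rotation [v i] is meant to carry a target point to 1, so a real part above [r] expresses
    closeness to that target. *)
Lemma exists_unit_dense (R : realType) (I : finType) (L : nat) (U : set R[i])
    (v : I -> R[i]) (r : R) :
  infinite_set U -> (forall z, U z -> `|z| = 1) -> (forall i, `|v i| = 1) ->
  0 <= r < 1 ->
  exists n : 'I_L -> nat, forall c : {ffun 'I_L -> I}, exists2 z, U z &
    forall l, r < complex.Re (v (c l) * z ^+ n l).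
Proof.
move=> Uinf U1 v1 /andP[r0 r1].
(* [rho ^+ p] bounds the kernel wherever the real part is at most [r]; [p] is chosen to make it less
   than half of [mu ^+ L]. *)
pose rho := (1 + r) / 2.
have rho01 : 0 < rho < 1 by rewrite /rho; lra.
have [p rhop] := poly_lt_geom _ _ L rho01.
pose mu := kernel_mean R p.
have /andP[mu0 mu1] := kernel_mean_ge0_le1 R p.
have muge := kernel_mean_ge R p.
have mu_gt0 : 0 < mu.
  by rewrite lt_neqAle mu0 andbT; apply/eqP => e; move: muge; rewrite -/mu -e; lra.
have muL0 : 0 < mu ^+ L by rewrite exprn_gt0.
have rhomu : 2 * rho ^+ p < mu ^+ L.
  rewrite -(@ltr_pM2l _ (p.*2.+1%:R ^+ L)) ?exprn_gt0 // -exprMn mulrCA mulrA.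
  by apply: lt_le_trans rhop _; rewrite exprn_ege1.
pose F := #|{ffun 'I_L -> I}|.
(* [k] is large enough for the second moment bound [F * k] to lie below [(k * mu ^+ L / 2) ^+ 2]. *)
pose k := Num.Def.archi_bound (4 * F%:R / (mu ^+ L) ^+ 2).
have kF : 4 * F%:R < k%:R * (mu ^+ L) ^+ 2.
  rewrite -ltr_pdivrMr ?exprn_gt0 //; apply: archi_boundP.
  by rewrite divr_ge0 ?mulr_ge0 ?exprn_ge0.
have k0 : 0 < k%:R :> R.
  rewrite lt_neqAle ler0n andbT; apply/eqP => e; move: kF; rewrite -e mul0r.
  by rewrite ltNge mulr_ge0.
have U0 z : U z -> z != 0 by move=> /U1 z1; rewrite -normr_eq0 z1 oner_eq0.
have [xs [xsk xsU xs1 xsp]] := exists_indep_seq _ _ p k Uinf U0.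
pose x (i : 'I_k) := xs`_i.
have xmem i : x i \in xs by rewrite mem_nth ?xsk.
have xU i : U (x i) by apply: xsU.
have xlt (i j : 'I_k) : (i < j)%N -> indep p (x i) (x j).
  by move=> ij; apply/asboolP; apply: (pairwiseP 0 xsp) => //; rewrite inE xsk.
have xindep (i j : 'I_k) : i != j -> indep p (x i) (x j).
  rewrite neq_ltn => /orP[/xlt//|/xlt h] s t sp tp.
  by rewrite mulrC [X in _ = X]mulrC => /h[].
pose g (c : I) (i : 'I_k) (m : nat) := kernel p (v c * x i ^+ m).
have w1 c i m : `|v c * x i ^+ m| = 1.
  by rewrite normrM normrX v1 (U1 _ (xU i)) expr1n mulr1.
have [|||||n nP] := @second_moment R I k L g mu ((k%:R * mu ^+ L / 2) ^+ 2).
- by move=> c i m; exact: kernel_ge0_le1.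
- by rewrite mu0.
- move=> c i; apply: cvg_mean_kernel => //; first exact: U1.
  by move=> s; apply: xs1.
- by move=> c i j ij; apply: cvg_mean_kernel2; [|exact: U1|exact: U1|exact: xindep].
- rewrite natrM -/F.
  have -> : (k%:R * mu ^+ L / 2) ^+ 2 = k%:R * (mu ^+ L) ^+ 2 / 4 * k%:R by field.
  by rewrite ltr_pM2r // ltr_pdivlMr // mulrC.
exists n => c.
suff [i fi] : exists i, rho ^+ p < \prod_l g (c l) i (n l).
  exists (x i) => // l.
  rewrite ltNge; apply/negP => lr; move: fi; apply/negP; rewrite -leNgt.
  rewrite (bigD1 l) //=; apply: (@le_trans _ _ (g (c l) i (n l))).
    rewrite ler_piMr //; first by case/andP: (kernel_ge0_le1 _ p _ (w1 (c l) i (n l))).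
    by apply: prodr_ile1 => j _; exact: kernel_ge0_le1.
  apply: lerXn2r.
  - rewrite nnegrE.
    have : `|complex.Re (v (c l) * x i ^+ n l)| <= 1.
      by rewrite -lecR (le_trans (normc_ge_Re _)) // w1.
    by rewrite ler_norml => /andP[]; lra.
  - by rewrite nnegrE; case/andP: rho01 => /ltW.
  - by rewrite /rho; lra.
(* If every product were at most [rho ^+ p], each deviation would be at most [- mu ^+ L / 2], and
   the square of their sum would reach the threshold. *)
apply: contrapT => /forallNP small; move: (nP c); apply/negP; rewrite -leNgt.
have nn : 0 <= k%:R * mu ^+ L / 2 by rewrite divr_ge0 // mulr_ge0 // ltW.
have big : k%:R * mu ^+ L / 2 <= - \sum_i (\prod_l g (c l) i (n l) - mu ^+ L).
  rewrite -sumrN -mulrA mulr_natl -[X in _ *+ X]card_ord -sumr_const.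
  apply: ler_sum => i _; have := small i; move/negP; rewrite -leNgt; lra.
by rewrite -[leRHS]sqrrN lerXn2r // nnegrE // (le_trans nn).
Qed.

(** * Multiplication maps on the circle and the torus *)

Lemma to_circleD (R : realType) (x y : R) :
  to_circle (x + y) = to_circle x + to_circle y.
Proof. by rewrite /to_circle; exact: (Quotient.pi_add). Qed.

Lemma to_circleMn (R : realType) (x : R) (n : nat) :
  to_circle (x *+ n) = to_circle x *+ n.
Proof.
elim: n => [|n IH]; last by rewrite !mulrS to_circleD IH.
by apply: (addrI (to_circle 0)); rewrite -to_circleD !mulr0n !addr0.
Qed.

Lemma eq_to_circle (R : realType) (x y : R) :
  to_circle x = to_circle y <-> x - y \is a Num.int.
Proof.
have e := Quotient.idealrBE (@integers R) x y; split=> h.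
  by suff : x - y \in @integers R by []; rewrite e; apply/eqP.
by have : x - y \in @integers R by []; rewrite e => /eqP.
Qed.

Lemma to_circleK (R : realType) (y : circle R) : to_circle (repr y) = y.
Proof. exact: reprK. Qed.

Lemma continuous_circleMn (R : realType) (n : nat) :
  continuous (fun y : circle R => y *+ n).
Proof.
apply/quotient_continuous.
rewrite (_ : _ \o _ = (@to_circle R) \o (fun x => x *+ n)).
  move=> x; apply: continuous_comp; first exact: natmul_continuous.
  exact: pi_continuous.
by apply/funext => x /=; rewrite to_circleMn.
Qed.

(** This is the integer matrix whose column [i] is [n] and whose other columns vanish. *)
Definition coord_muln {R : realType} {N L : nat} (i : 'I_N) (n : 'I_L -> nat)
  (y : torus R N) : torus R L := \col_l (y i ord0 *+ n l).

Lemma coord_muln_is_zmod_morphism (R : realType) (N L : nat) (i : 'I_N)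
  (n : 'I_L -> nat) : zmod_morphism (@coord_muln R N L i n).
Proof. by move=> x y; apply/matrixP => l j; rewrite !mxE mulrnBl. Qed.

HB.instance Definition _ (R : realType) (N L : nat) (i : 'I_N)
  (n : 'I_L -> nat) := GRing.isZmodMorphism.Build (torus R N) (torus R L)
    (@coord_muln R N L i n) (@coord_muln_is_zmod_morphism R N L i n).

Lemma continuous_coord_muln (R : realType) (N L : nat) (i : 'I_N)
  (n : 'I_L -> nat) : continuous (@coord_muln R N L i n).
Proof.
move=> y A [P yP PA].
have h l : nbhs (y i ord0) [set t | P l ord0 (t *+ n l)].
  apply: (@continuous_circleMn R (n l) (y i ord0)).
  by have := yP l ord0; rewrite mxE.
(* The image depends on coordinate [i] only, so the finitely many conditions indexed by [l] are
   intersected there. *)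
exists (fun i' _ => if i' == i
    then [set t | forall l, P l ord0 (t *+ n l)] else setT).
  move=> i' j'; case: eqP => [->|_]; last exact: filterT.
  rewrite ord1 /=.
  have hh : \forall t \near y i ord0, forall l, P l ord0 (t *+ n l).
    exact: filter_forall h.
  exact: hh.
move=> z zP; apply: PA => l j; rewrite mxE ord1.
by have := zP i ord0; rewrite eqxx; apply.
Qed.

(** If every coordinate took finitely many values, [X] would lie in the finite set of vectors with
    entries in the collected list [S]. *)
Lemma infinite_coord (T : choiceType) (N : nat) (X : set 'cV[T]_N) :
  infinite_set X -> exists i, infinite_set ((fun y : 'cV_N => y i ord0) @` X).
Proof.
move=> Xinf; apply: contrapT => /forallNP fin; apply: Xinf.
have /choice[s sP] : forall i, exists s : seq T,
    (fun y : 'cV_N => y i ord0) @` X = [set` s].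
  by move=> i; apply/finite_seqP; exact: contrapT (fin i).
pose S := flatten [seq s i | i <- enum 'I_N].
have memS i y : X y -> y i ord0 \in S.
  move=> Xy; apply/flatten_mapP; exists i; first by rewrite mem_enum.
  have : [set` s i] (y i ord0) by rewrite -sP; exists y.
  by [].
apply: (@sub_finite_set _ _ ((fun f : {ffun 'I_N -> seq_sub S} =>
    \col_i val (f i)) @` setT)); last by apply: finite_image; exact: finite_finset.
move=> y Xy; exists [ffun i => SeqSub (memS i y Xy)] => //.
by apply/matrixP => i j; rewrite (ord1 j) mxE ffunE.
Qed.

(** * The exponential map and distance to the integers *)

Definition cis {R : realType} (x : R) : R[i] :=
  Complex (cos (2 * pi * x)) (sin (2 * pi * x)).

Lemma norm_cis (R : realType) (x : R) : `|cis x| = 1.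
Proof. by rewrite normc_def /= cos2Dsin2 sqrtr1. Qed.

Lemma cisD (R : realType) (x y : R) : cis (x + y) = cis x * cis y.
Proof.
apply/eqP; rewrite eq_complex /= mulrDr cosD sinD eqxx /=.
by rewrite addrC.
Qed.

Lemma cisMn (R : realType) (x : R) (n : nat) : cis (x *+ n) = cis x ^+ n.
Proof.
elim: n => [|n IH]; last by rewrite mulrS exprS cisD IH.
by rewrite mulr0n expr0 /cis mulr0 cos0 sin0.
Qed.

Lemma cos_periodic (R : realType) (x : R) (k : int) :
  cos (2 * pi * (x - k%:~R)) = cos (2 * pi * x).
Proof.
have h (n : nat) (y : R) : cos (2 * pi * (y + n%:R)) = cos (2 * pi * y).
  elim: n => [|n IH]; first by rewrite addr0.
  by rewrite -(natr1 n) addrA mulrDr mulr1 [2 * pi]mulr_natl cosD2pi -mulr_natl IH.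
case: k => n; first by rewrite -[in RHS](subrK n%:R x) h.
by rewrite NegzE mulrNz opprK h.
Qed.

(** Reduces angles to [0, pi], where the cosine is injective and decreasing. *)
Lemma cos_nearest_int (R : realType) (x : R) : exists k : int,
  `|x - k%:~R| <= 1 / 2 /\ cos (2 * pi * x) = cos (2 * pi * `|x - k%:~R|).
Proof.
exists (Num.floor (x + 1 / 2)); split.
  have := floor_itv (x + 1 / 2).
  by rewrite intrD ler_norml => /andP[]; lra.
rewrite -[in LHS](cos_periodic _ x (Num.floor (x + 1 / 2))).
rewrite -[LHS]cos_norm normrM ger0_norm // mulr_ge0 // pi_ge0 //.
Qed.

Lemma twopi_itv (R : realType) (x : R) : 0 <= x <= 1 / 2 -> 2 * pi * x \in `[0, pi].
Proof. by move=> /andP[x0 x1]; rewrite in_itv /=; have := pi_ge0 R; nra. Qed.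

Lemma cos_gt_near_int (R : realType) (d x : R) : 0 <= d <= 1 / 2 ->
  cos (2 * pi * d) < cos (2 * pi * x) -> exists k : int, `|x - k%:~R| < d.
Proof.
move=> dd; have [k [xk ->]] := cos_nearest_int _ x => lt; exists k.
move: lt; rewrite ltr_cos ?twopi_itv ?normr_ge0 // ltr_pM2l //.
by rewrite mulr_gt0 // pi_gt0.
Qed.

Lemma cis_eq_int (R : realType) (x y : R) : cis x = cis y -> x - y \is a Num.int.
Proof.
move=> e.
have [k [xk ck]] := cos_nearest_int _ (x - y).
(* Equal cosines and sines turn the subtraction formula into cos^2 + sin^2 = 1. *)
have : cos (2 * pi * (x - y)) = cos (2 * pi * 0).
  case: e => e1 e2; rewrite mulrBr cosB e1 e2 -!expr2 cos2Dsin2.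
  by rewrite mulr0 cos0.
rewrite ck => /cos_inj; rewrite !twopi_itv ?normr_ge0 ?lexx //; last by lra.
have tp : 2 * pi != 0 :> R by rewrite mulf_neq0 // gt_eqF // pi_gt0.
move=> /(_ isT isT) /(mulfI tp) /eqP; rewrite normr_eq0 subr_eq0 => /eqP ->.
exact: intr_int.
Qed.

(** Euclidean division by [Q] of the floor of [b * Q%:R] gives [k] as quotient and [q] as
    remainder. *)
Lemma near_grid (R : realType) (Q : nat) (b : R) : (0 < Q)%N ->
  exists (q : 'I_Q) (k : int), `|b - k%:~R - q%:R / Q%:R| <= Q%:R^-1.
Proof.
move=> Q0; have QR : 0 < Q%:R :> R by rewrite ltr0n.
pose m := Num.floor (b * Q%:R).
have Qz : Q%:Z != 0 by rewrite eqz_nat -lt0n.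
have qlt : (`|(m %% Q)%Z|%N < Q)%N.
  by rewrite -ltz_nat gez0_abs ?modz_ge0 // ltz_pmod // ltz_nat.
exists (Ordinal qlt), (m %/ Q)%Z => /=.
have mE : m%:~R = (m %/ Q)%Z%:~R * Q%:R + `|(m %% Q)%Z|%N%:R :> R.
  rewrite [in LHS](divz_eq m Q%:Z) intrD intrM; congr (_ + _).
  by rewrite -[in LHS](gez0_abs (modz_ge0 m Qz)).
have -> : b - (m %/ Q)%Z%:~R - `|(m %% Q)%Z|%N%:R / Q%:R =
    (b * Q%:R - m%:~R) / Q%:R.
  by rewrite mE; field; rewrite gt_eqF.
rewrite normrM normfV (gtr0_norm QR) ler_piMl ?invr_ge0 ?ler0n //.
have := floor_itv (b * Q%:R); rewrite -/m intrD => /andP[h1 h2].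
by rewrite ger0_norm; lra.
Qed.

Lemma is_circle_interval_interior (R : realType) (len : R) (J : set (circle R)) :
  is_circle_interval len J ->
  exists a, forall t, a < t < a + len -> J (to_circle t).
Proof.
move=> [bl [br [a ->]]]; exists a => t /andP[at_ ta]; exists t => //=.
rewrite in_itv /=; apply/andP; split.
  by case: bl; rewrite /= ?ltW.
by case: br; rewrite /= ?ltW.
Qed.

(** * Transfer from the unit circle to the torus *)

Theorem theorem1p1 (R : realType) (N L : nat) (N_gt0 : (0 < N)%N)
    (L_gt0 : (0 < L)%N) (eps : R) (eps_gt0 : 0 < eps)
    (X : set (torus R N)) (X_infinite : infinite_set X) :
  exists T : {additive torus R N -> torus R L},
    continuous (T : torus R N -> torus R L) /\ eps_dense eps (T @` X).
Proof.
have [i Yinf] := infinite_coord _ _ _ X_infinite.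
set Y := _ @` X in Yinf.
(* Two errors below [d], from the grid and from the approximation, must fit in [eps]; [d <= 1 / 8]
   keeps [cos (2 * pi * d)] nonnegative. *)
pose d := Num.min eps (1 / 4) / 2.
have [d0 d8 deps] : [/\ 0 < d, d <= 1 / 8 & 2 * d <= eps].
  by rewrite /d minEle; case: ifPn; rewrite -?ltNge => h; split; lra.
have r01 : 0 <= cos (2 * pi * d) < 1.
  apply/andP; split.
    by apply: cos_ge0_pihalf; have := pi_ge0 R; move=> ?; apply/andP; split; nra.
  suff: cos (2 * pi * d) < cos (2 * pi * 0) by rewrite mulr0 cos0.
  rewrite ltr_cos ?twopi_itv ?lexx //=; last by lra.
  by rewrite ltr_pM2l // mulr_gt0 // pi_gt0.
pose Q := Num.Def.archi_bound d^-1.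
have Qd : d^-1 < Q%:R by apply: archi_boundP; rewrite invr_ge0 ltW.
have Q0 : (0 < Q)%N by rewrite -(ltr0n R) (lt_trans _ Qd) // invr_gt0.
have Qinv : Q%:R^-1 < d by rewrite invf_plt ?posrE ?ltr0n.
pose U := (fun y : circle R => cis (repr y)) @` Y.
have Uinf : infinite_set U.
  have cis_inj : {in Y &, injective (fun y : circle R => cis (repr y))}.
    by move=> y y' _ _ /cis_eq_int/eq_to_circle; rewrite !to_circleK.
  by rewrite (eq_finite_set (inj_card_eq cis_inj)).
have U1 z : U z -> `|z| = 1 by move=> [y _ <-]; exact: norm_cis.
(* The targets are the grid points [q / Q], so the rotations use the opposite angles. *)
have [n nP] := @exists_unit_dense R 'I_Q L U (fun q => cis (- (q%:R / Q%:R))) _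
  Uinf U1 (fun=> norm_cis _ _) r01.
exists (coord_muln i n); split; first exact: continuous_coord_muln.
move=> J JP.
have /choice[a aP] : forall l, exists a, forall t,
     a < t < a + 2 * eps -> J l (to_circle t).
  by move=> l; exact: is_circle_interval_interior.
(* The target in coordinate [l] is a grid point near the centre [a l + eps] of the interval. *)
have /choice[q qP] := fun l : 'I_L => @near_grid R Q (a l + eps) Q0.
have [_ [y' [y Xy <-] <-] zP] := nP [ffun l => q l].
exists (coord_muln i n y); split; first by exists y.
move=> l; rewrite mxE; have := zP l; rewrite ffunE.
set x := repr _ => xP.
rewrite -[y i ord0]to_circleK -/x -to_circleMn.
have [k kP] := qP l.
have [k' k'P] : exists k : int, `|x *+ n l - (q l)%:R / Q%:R - k%:~R| < d.
  apply: cos_gt_near_int; first by lra.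
  by move: xP; rewrite -cisMn -cisD addrC.
(* This representative is within [2 * d] of the centre, hence strictly inside the interval. *)
have -> : to_circle (x *+ n l) = to_circle (x *+ n l - k'%:~R + k%:~R).
  apply/eq_to_circle; rewrite (_ : _ - _ = (k' - k)%:~R) ?intr_int //.
  by rewrite intrB; ring.
apply: aP; move: kP k'P; rewrite ler_norml ltr_norml => /andP[? ?] /andP[? ?].
by apply/andP; split; lra.
Qed.
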